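(* Let $u(x,t)=p_1(t)e^{-|x-q_1(t)|}+p_2(t)e^{-|x-q_2(t)|}$ be a twopeakon solution to the Camassa--Holm equation with initial data $(q(0),p(0))$ satisfying $q(0)\in\Omega=\{(q_1,q_2)\in\mathbb{R}^2 : q_1>q_2\}$. Then there is a collision not later than at time $$t^*=\frac{2\sqrt{1-y(0)}}{y(0)\sqrt{(1+y(0))(2H_1-H_0^2)}},$$ where $y(0)=e^{q_2(0)-q_1(0)}$, or $$q_1(t)-q_2(t)\rightarrow\infty\quad\text{when}\quad t\rightarrow\infty.$$
   Context: The Camassa--Holm equation is $u_t-u_{xxt}+3uu_x-2u_xu_{xx}-uu_{xxx}=0$. A twopeakon solution is a function $u(x,t)=\sum_{i=1}^2 p_i(t)e^{-|x-q_i(t)|}$ where $q=(q_1,q_2)$ and $p=(p_1,p_2)$ evolve according to the Hamiltonian system $\dot q_i=\partial H/\partial p_i$, $\dot p_i=-\partial H/\partial q_i$, $i=1,2$, with $H(q,p)=\frac12\sum_{i,j=1}^2 p_ip_je^{-|q_i-q_j|}$. The quantities $H_0=p_1+p_2$ and $H_1=H(q,p)=\frac12\sum_{i,j=1}^2 p_ip_je^{-|q_i-q_j|}$ are first integrals of this system, i.e. constant along solutions. The twopeakon collides at time $\tau>0$ (there is a collision at time $\tau$) if $q_1(\tau)=q_2(\tau)$.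
   Formalization: The formal statement adds 2H_1 - H_0^2 ≠ 0 (both initial momenta nonzero), so that t* is defined; without it the claim fails, e.g. p(0) = (-1, 0), where q_1 - q_2 decreases to 0 without a collision. *)

(* Defs.v *)
From HB Require Import structures.
From mathcomp Require Import all_boot all_order all_algebra.
From mathcomp Require Import all_classical all_reals all_analysis.
Set Implicit Arguments.
Unset Strict Implicit.
Unset Printing Implicit Defensive.
Import Order.TTheory GRing.Theory Num.Theory.
Import numFieldNormedType.Exports.
Local Open Scope classical_set_scope.
Local Open Scope ring_scope.

(* The index set {1, 2} is 'I_2: the first peakon has index [ord0] and the
   second one index [ord_max]. *)

Definition Omega (R : realType) : set 'rV[R]_2 :=
  [set q | q ord0 ord_max < q ord0 ord0].
Arguments Omega : clear implicits.

Definition H0 (R : realType) (p : 'rV[R]_2) : R := \sum_(i < 2) p ord0 i.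

Definition H (R : realType) (q p : 'rV[R]_2) : R :=
  2^-1 * \sum_(i < 2) \sum_(j < 2)
    p ord0 i * p ord0 j * expR (- `|q ord0 i - q ord0 j|).

Definition partial (R : realType) (n : nat) (i : 'I_n)
    (f : 'rV[R]_n -> R) (x : 'rV[R]_n) : R :=
  'D_(delta_mx ord0 i) f x.

Definition collision (R : realType) (q : R -> 'rV[R]_2) (tau : R) : Prop :=
  q tau ord0 ord0 = q tau ord0 ord_max.

Definition no_collision_upto (R : realType) (q : R -> 'rV[R]_2) (t : R) : Prop :=
  forall s, 0 <= s <= t -> ~ collision q s.

(* [H] is not differentiable in q where q_1 = q_2, and p may become unbounded
   as t approaches a collision time.  So the positions are required to be
   continuous on [0, +oo), while Hamilton's equations (and the formula for u)
   are only required up to the first collision; nothing is assumed on how the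
   solution is continued afterwards, and the values of p from then on are
   irrelevant.  At the endpoint t = 0, right-continuity of p replaces the
   differential equations (q is right-continuous by the first condition). *)
Record twopeakon_solution (R : realType)
    (u : R -> R -> R) (q p : R -> 'rV[R]_2) : Prop := TwopeakonSolution {
  twopeakon_profile : forall x t, 0 <= t -> no_collision_upto q t ->
    u x t = \sum_(i < 2) p t ord0 i * expR (- `|x - q t ord0 i|);
  twopeakon_q_continuous : {within `[0, +oo[, continuous q};
  twopeakon_p_initial : p t @[t --> 0^'+] --> p 0;
  twopeakon_q_ode : forall t, 0 < t -> no_collision_upto q t ->
    forall i : 'I_2,
      is_derive t 1 (fun s => q s ord0 i) (partial i (fun p' => H (q t) p') (p t));
  twopeakon_p_ode : forall t, 0 < t -> no_collision_upto q t ->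
    forall i : 'I_2,
      is_derive t 1 (fun s => p s ord0 i) (- partial i (fun q' => H q' (p t)) (q t))
}.

Definition tstar (R : realType) (q0 p0 : 'rV[R]_2) : R :=
  let y0 := expR (q0 ord0 ord_max - q0 ord0 ord0) in
  2 * Num.sqrt (1 - y0)
    / (y0 * Num.sqrt ((1 + y0) * (2 * H q0 p0 - H0 p0 ^+ 2))).

(* Main.v *)
Require Import Defs.
From HB Require Import structures.
From mathcomp Require Import all_boot all_order all_algebra.
From mathcomp Require Import all_classical all_reals all_analysis.
From mathcomp Require Import ring lra.
Set Implicit Arguments.
Unset Strict Implicit.
Unset Printing Implicit Defensive.
Import Order.TTheory GRing.Theory Num.Theory.
Import numFieldNormedType.Exports.
Local Open Scope classical_set_scope.
Local Open Scope ring_scope.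

(** Write z = q_1 - q_2 for the distance, w = p_1 - p_2 for the relative
momentum and y = exp (- z).  As long as z > 0, Hamilton's equations give

  z' = w (1 - y)   and   (p_1 p_2)' = - p_1 p_2 w y,

so that K = p_1 p_2 (1 - y) is conserved, together with S = p_1 + p_2.  Hence
(z, w) is an autonomous planar system,

  z' = w (1 - y),   w' = 2 K y / (1 - y),
  w^2 (1 - y) = S^2 (1 - y) - 4 K,

and 2 H_1 - H_0^2 = - 2 K.  The hypothesis on the denominator of t* thus says
that K is nonzero, and everything is decided by the sign of K and of w(0).

- If K < 0 (a peakon and an antipeakon), the energy identity keeps w away from
  0, so w keeps its initial sign.
  If w(0) > 0, then z increases at a rate bounded below, and tends to infinity
  ([separating_rate]).
  If w(0) < 0, then y increases, and
    (sqrt (1 - y))' = w y sqrt (1 - y) / 2 <= - y(0) sqrt (- 4 K) / 2;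
  a positive function cannot decrease at this rate for longer than
  2 sqrt (1 - y(0)) / (y(0) sqrt (- 4 K)), and this is smaller than t*, where
  the factor 2 of - 4 K = 2 (- 2 K) is replaced by 1 + y(0) < 2
  ([approaching_time]).
- If K > 0 (momenta of the same sign), the energy identity bounds 1 - y, hence
  z, away from 0, so there is no collision.  Moreover w increases, and it must
  become positive: while w <= 0, the distance does not grow, and w' is at least
  2 K y(0) ([attracting_turn]).  From then on z' is bounded below by a positive
  constant.

The equations of motion hold only up to the first collision.  So the absence of
a collision is obtained by a continuation argument: a lower bound on z, valid
as long as no collision has occurred, persists
([no_collision_of_lower_bound]). *)

(** * Functions with a given derivative on a half-open interval *)

(** At 0 only right-continuity is asked for: a solution is defined for t >= 0,
and its equations hold for t > 0.  On the other hand T is included, so that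
left-continuity at T comes for free from differentiability. *)
Definition primitive_upto (R : realType) (T : R) (f df : R -> R) : Prop :=
  f x @[x --> 0^'+] --> f 0 /\ forall x, 0 < x <= T -> is_derive x 1 f (df x).

Lemma primitive_upto_eq (R : realType) (T : R) (f df dg : R -> R) :
  primitive_upto T f df -> (forall x, 0 < x <= T -> df x = dg x) ->
  primitive_upto T f dg.
Proof. by move=> [f0 fd] e; split=> // x xT; rewrite -e//; exact: fd. Qed.

Lemma primitive_uptoW (R : realType) (T T' : R) (f df : R -> R) :
  T' <= T -> primitive_upto T f df -> primitive_upto T' f df.
Proof.
move=> T'T [f0 fd]; split=> // x /andP[x0 xT'].
by apply: fd; rewrite x0 (le_trans xT').
Qed.

Lemma primitive_uptoD (R : realType) (T : R) (f df g dg : R -> R) :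
  primitive_upto T f df -> primitive_upto T g dg ->
  primitive_upto T (fun x => f x + g x) (fun x => df x + dg x).
Proof.
move=> [f0 fd] [g0 gd]; split=> [|x xT]; first exact: cvgD.
exact: (is_deriveD (fd x xT) (gd x xT)).
Qed.

Lemma primitive_uptoN (R : realType) (T : R) (f df : R -> R) :
  primitive_upto T f df ->
  primitive_upto T (fun x => - f x) (fun x => - df x).
Proof.
move=> [f0 fd]; split=> [|x xT]; first exact: cvgN.
exact: (is_deriveN (fd x xT)).
Qed.

Lemma primitive_uptoB (R : realType) (T : R) (f df g dg : R -> R) :
  primitive_upto T f df -> primitive_upto T g dg ->
  primitive_upto T (fun x => f x - g x) (fun x => df x - dg x).
Proof. by move=> fT /primitive_uptoN; exact: primitive_uptoD. Qed.

Lemma primitive_uptoM (R : realType) (T : R) (f df g dg : R -> R) :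
  primitive_upto T f df -> primitive_upto T g dg ->
  primitive_upto T (fun x => f x * g x) (fun x => f x * dg x + g x * df x).
Proof.
move=> [f0 fd] [g0 gd]; split=> [|x xT]; first exact: cvgM.
exact: (is_deriveM (fd x xT) (gd x xT)).
Qed.

Lemma primitive_upto_comp (R : realType) (T : R) (h dh f df : R -> R) :
  {for f 0, continuous h} ->
  (forall x, 0 < x <= T -> is_derive (f x) 1 h (dh (f x))) ->
  primitive_upto T f df ->
  primitive_upto T (fun x => h (f x)) (fun x => dh (f x) * df x).
Proof.
move=> h0 hd [f0 fd]; split=> [|x xT]; first exact: continuous_cvg.
exact: (is_derive1_comp (hd x xT) (fd x xT)).
Qed.

Lemma primitive_upto_continuous (R : realType) (T : R) (f df : R -> R) :
  0 < T -> primitive_upto T f df -> {within `[0, T], continuous f}.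
Proof.
move=> T0 [f0 fd].
have fc x : 0 < x <= T -> {for x, continuous f}.
  move=> /fd [d _]; apply/differentiable_continuous.
  exact/derivable1_diffP.
apply/continuous_within_itvP => //; split => //.
  by move=> x; rewrite in_itv/= => /andP[x0 /ltW xT]; apply: fc; rewrite x0.
by apply: cvg_at_left_filter; apply: fc; rewrite T0 lexx.
Qed.

Lemma primitive_upto_ge (R : realType) (T c a b : R) (f df : R -> R) :
  primitive_upto T f df -> 0 <= a -> a <= b -> b <= T ->
  (forall x, a < x < b -> c <= df x) -> c * (b - a) <= f b - f a.
Proof.
move=> fT a0 ab bT dfc.
have [->|ba] := eqVneq a b; first by rewrite !subrr mulr0.
have {ab}ab : a < b by rewrite lt_neqAle ba.
have b0 : 0 < b by exact: le_lt_trans ab.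
have fb := primitive_uptoW bT fT.
have [||x xab ->] := @MVT R f df a b ab.
- move=> x; rewrite in_itv/= => /andP[ax xb].
  by case: fb => _; apply; rewrite (le_lt_trans a0)//= ltW.
- apply: continuous_subspaceW (primitive_upto_continuous b0 fb) => x /=.
  by rewrite !in_itv/= => /andP[ax ->]; rewrite (le_trans a0).
- by rewrite ler_pM2r ?subr_gt0// dfc//; move: xab; rewrite in_itv.
Qed.

Lemma primitive_upto_le (R : realType) (T c a b : R) (f df : R -> R) :
  primitive_upto T f df -> 0 <= a -> a <= b -> b <= T ->
  (forall x, a < x < b -> df x <= c) -> f b - f a <= c * (b - a).
Proof.
move=> fT a0 ab bT dfc.
have : - c * (b - a) <= - f b - - f a.
  apply: (primitive_upto_ge (primitive_uptoN fT) a0 ab bT) => x xab.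
  by rewrite lerN2 dfc.
by rewrite mulNr; lra.
Qed.

Lemma primitive_upto_cst (R : realType) (T t : R) (f df : R -> R) :
  primitive_upto T f df -> (forall x, 0 < x <= T -> df x = 0) ->
  0 <= t <= T -> f t = f 0.
Proof.
move=> fT df0 /andP[t0 tT].
have {}df0 x : 0 < x < t -> df x = 0.
  by move=> /andP[x0 xt]; apply: df0; rewrite x0 ltW// (lt_le_trans xt).
have le0 : f t - f 0 <= 0 * (t - 0).
  by apply: (primitive_upto_le fT) => // x /df0 ->.
have ge0 : 0 * (t - 0) <= f t - f 0.
  by apply: (primitive_upto_ge fT) => // x /df0 ->.
by move: le0 ge0; rewrite mul0r; lra.
Qed.

Lemma nonvanishing_gt0 (R : realType) (a b : R) (f : R -> R) :
  a <= b -> {within `[a, b], continuous f} ->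
  (forall x, a <= x <= b -> f x != 0) -> 0 < f a -> 0 < f b.
Proof.
move=> ab fc fn fa; rewrite ltNge; apply/negP => fb.
have [|x] := @IVT R f a b 0 ab fc.
  by rewrite ge_min le_max fb (ltW fa) orbT.
by rewrite in_itv/= => /fn /eqP.
Qed.

(** * Partial derivatives of the Hamiltonian *)

(** A directional derivative is the derivative at 0 of a function of one real
variable; this reduces the partial derivatives of the Hamiltonian to calculus on
the real line. *)
Lemma derive_along_line (R : realType) (V : normedModType R) (f : V -> R)
  (x v : V) : 'D_v f x = 'D_1 (fun h : R => f (h *: v + x)) 0.
Proof.
rewrite -derive1E /derive /derive1.
by under [in RHS]eq_fun do rewrite addr0 scale0r add0r.
Qed.

Lemma H_twopeakon (R : realType) (q p : 'rV[R]_2) :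
  H q p = 2^-1 * (p ord0 ord0 ^+ 2 + p ord0 ord_max ^+ 2)
    + p ord0 ord0 * p ord0 ord_max
        * expR (- `|q ord0 ord0 - q ord0 ord_max|).
Proof.
rewrite /H !big_ord_recr !big_ord0/=.
rewrite (_ : widen_ord _ _ = ord0); last exact/val_inj.
rewrite !subrr !normr0 oppr0 expR0 (distrC (q ord0 ord_max)).
by field.
Qed.

Lemma H_Omega (R : realType) (q p : 'rV[R]_2) : Omega R q ->
  H q p = 2^-1 * (p ord0 ord0 ^+ 2 + p ord0 ord_max ^+ 2)
    + p ord0 ord0 * p ord0 ord_max
        * expR (q ord0 ord_max - q ord0 ord0).
Proof.
by rewrite /Omega/= => q21; rewrite H_twopeakon gtr0_norm ?subr_gt0// opprB.
Qed.

Lemma derive_quadratic0 (R : realType) (a b c : R) (f : R -> R) :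
  (forall h, f h = a * h ^+ 2 + b * h + c) -> 'D_1 f 0 = b.
Proof.
move=> /funext ->; apply: derive_val; apply: is_derive_eq.
by rewrite /GRing.scale/= !(mul0r, mulr0, mulr1, addr0, add0r).
Qed.

Lemma derive_expR_affine0 (R : realType) (a b s l : R) :
  'D_1 (fun h : R => a + b * expR (s * h + l)) 0 = b * s * expR l.
Proof.
apply: derive_val; apply: is_derive_eq.
rewrite /GRing.scale/= !(mul0r, mulr0, mulr1, addr0, add0r).
by rewrite mul1r mulrA mulrAC.
Qed.

Section partial_derivatives.
Variables (R : realType) (q p : 'rV[R]_2).
Hypothesis q_Omega : Omega R q.

Lemma partial_p_ord0 : partial ord0 (fun p' => H q p') p =
  p ord0 ord0 + p ord0 ord_max * expR (q ord0 ord_max - q ord0 ord0).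
Proof.
rewrite /partial derive_along_line.
under eq_fun do rewrite H_Omega// !mxE/= mulr0 mulr1 add0r.
move: (expR _) (p _ _) (p _ _) => y a b.
apply: (derive_quadratic0 (a := 2^-1)
  (c := 2^-1 * (a ^+ 2 + b ^+ 2) + a * b * y)) => h; by field.
Qed.

Lemma partial_p_ord_max : partial ord_max (fun p' => H q p') p =
  p ord0 ord_max + p ord0 ord0 * expR (q ord0 ord_max - q ord0 ord0).
Proof.
rewrite /partial derive_along_line.
under eq_fun do rewrite H_Omega// !mxE/= mulr0 mulr1 add0r.
move: (expR _) (p _ _) (p _ _) => y b a.
apply: (derive_quadratic0 (a := 2^-1)
  (c := 2^-1 * (a ^+ 2 + b ^+ 2) + a * b * y)) => h; by field.
Qed.

(** Unlike for the momenta, the formula [H_Omega] holds only for small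
displacements along the line, those that stay in the open set [Omega]. *)
Lemma partial_q_ord0 : partial ord0 (fun q' => H q' p) q =
  - (p ord0 ord0 * p ord0 ord_max * expR (q ord0 ord_max - q ord0 ord0)).
Proof.
rewrite /partial derive_along_line -mulrN1 mulrAC.
rewrite -[RHS](derive_expR_affine0
  (2^-1 * (p ord0 ord0 ^+ 2 + p ord0 ord_max ^+ 2))).
apply: near_eq_derive; near=> h.
rewrite H_Omega ?/Omega/= !mxE/= mulr0 mulr1 add0r; last first.
  rewrite -ltrBlDr; near: h; apply: lt_nbhsr.
  by move: q_Omega; rewrite /Omega/=; lra.
by congr (_ + _ * expR _); ring.
Unshelve. all: by end_near. Qed.

Lemma partial_q_ord_max : partial ord_max (fun q' => H q' p) q =
  p ord0 ord0 * p ord0 ord_max * expR (q ord0 ord_max - q ord0 ord0).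
Proof.
rewrite /partial derive_along_line -[X in X * expR _]mulr1.
rewrite -[RHS](derive_expR_affine0
  (2^-1 * (p ord0 ord0 ^+ 2 + p ord0 ord_max ^+ 2))).
apply: near_eq_derive; near=> h.
rewrite H_Omega ?/Omega/= !mxE/= mulr0 mulr1 add0r; last first.
  rewrite -ltrBrDr; near: h; apply: lt_nbhsl.
  by move: q_Omega; rewrite /Omega/=; lra.
by congr (_ + _ * expR _); ring.
Unshelve. all: by end_near. Qed.

End partial_derivatives.

(** * The relative motion of two peakons *)

(** The planar system satisfied by the distance z and the relative momentum w of
the two peakons on [0, T].  Here K is the constant p_1 p_2 (1 - exp (- z)), and
S is the total momentum; [energy] is the identity
(p_1 - p_2)^2 = (p_1 + p_2)^2 - 4 p_1 p_2, multiplied by 1 - exp (- z). *)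
Record relative_motion (R : realType) (K S : R) (z w : R -> R) (T : R) : Prop :=
  RelativeMotion {
  distance_ode : primitive_upto T z (fun t => w t * (1 - expR (- z t)));
  momentum_ode : primitive_upto T w
    (fun t => 2 * K * expR (- z t) / (1 - expR (- z t)));
  distance_gt0 : forall t, 0 <= t <= T -> 0 < z t;
  energy : forall t, 0 <= t <= T ->
    w t ^+ 2 * (1 - expR (- z t)) = S ^+ 2 * (1 - expR (- z t)) - 4 * K
}.

Lemma one_sub_expRN_gt0 (R : realType) (x : R) : 0 < x -> 0 < 1 - expR (- x).
Proof. by move=> x0; rewrite subr_gt0 expR_lt1 oppr_lt0. Qed.

Lemma one_sub_expRN_lt1 (R : realType) (x : R) : 1 - expR (- x) < 1.
Proof. by rewrite ltrBlDr ltrDl expR_gt0. Qed.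

Lemma one_sub_expRN_le (R : realType) (x : R) : 1 - expR (- x) <= x.
Proof. by have := expR_ge1Dx (- x); lra. Qed.

Lemma is_derive_one_sub_expRN (R : realType) (x : R) :
  is_derive x 1 (fun x : R => 1 - expR (- x)) (expR (- x)).
Proof.
apply: is_derive_eq.
by rewrite /GRing.scale/= add0r mul1r mulrN1 opprK.
Qed.

Lemma continuous_one_sub_expRN (R : realType) :
  continuous (fun x : R => 1 - expR (- x)).
Proof.
move=> x; apply/differentiable_continuous/derivable1_diffP.
by case: (is_derive_one_sub_expRN x).
Qed.

Section relative_motion.
Variables (R : realType) (K S : R) (z w : R -> R) (T : R).
Hypotheses (T_ge0 : 0 <= T) (zw : relative_motion K S z w T).

Lemma gap_gt0 t : 0 <= t <= T -> 0 < 1 - expR (- z t).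
Proof. by move=> tT; apply: one_sub_expRN_gt0; exact: (distance_gt0 zw). Qed.

Lemma energy_ge t : 0 <= t <= T -> - (4 * K) <= w t ^+ 2 * (1 - expR (- z t)).
Proof.
move=> tT; rewrite (energy zw tT) lerDr mulr_ge0 ?sqr_ge0// ltW//.
exact: gap_gt0.
Qed.

Lemma gap_ge t : 0 <= t <= T -> 4 * K <= S ^+ 2 * (1 - expR (- z t)).
Proof.
move=> tT; rewrite -subr_ge0 -(energy zw tT) mulr_ge0 ?sqr_ge0// ltW//.
exact: gap_gt0.
Qed.

Lemma momentum_neq0 t : K < 0 -> 0 <= t <= T -> w t != 0.
Proof.
move=> K0 tT; apply/eqP => wt0; have := energy_ge tT.
rewrite wt0 expr0n/= mul0r; lra.
Qed.

(** For K < 0 the energy identity forbids w = 0, so w cannot change sign. *)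
Lemma momentum_sign_gt0 t : K < 0 -> 0 < w 0 -> 0 <= t <= T -> 0 < w t.
Proof.
move=> K0 w0 /andP[t0 tT]; have [<-//|tn0] := eqVneq 0 t.
have t_gt0 : 0 < t by rewrite lt_neqAle tn0.
apply: (nonvanishing_gt0 t0 _ _ w0).
  exact: primitive_upto_continuous (primitive_uptoW tT (momentum_ode zw)).
by move=> x /andP[x0 xt]; rewrite momentum_neq0// x0 (le_trans xt).
Qed.

Lemma momentum_sign_lt0 t : K < 0 -> w 0 < 0 -> 0 <= t <= T -> w t < 0.
Proof.
move=> K0 w0 /andP[t0 tT]; have [<-//|tn0] := eqVneq 0 t.
have t_gt0 : 0 < t by rewrite lt_neqAle tn0.
rewrite -oppr_gt0.
apply: (nonvanishing_gt0 (f := fun x => - w x) t0); last by rewrite oppr_gt0.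
  move=> x; apply: continuousN.
  exact: primitive_upto_continuous (primitive_uptoW tT (momentum_ode zw)) x.
by move=> x /andP[x0 xt]; rewrite oppr_eq0 momentum_neq0// x0 (le_trans xt).
Qed.

Lemma separating_distance t : K < 0 -> 0 < w 0 -> 0 <= t <= T -> z 0 <= z t.
Proof.
move=> K0 w0 /andP[t0 tT].
rewrite -subr_ge0 -[X in X <= _](mul0r (t - 0)).
apply: (primitive_upto_ge (distance_ode zw)) => // x /andP[x0 xt].
have xT : 0 <= x <= T by rewrite ltW//= ltW// (lt_le_trans xt).
by apply: mulr_ge0; apply: ltW; [exact: momentum_sign_gt0|exact: gap_gt0].
Qed.

(** The energy identity gives w^2 >= - 4 K, because 1 - exp (- z) < 1, while
1 - exp (- z) does not decrease since z does not. *)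
Lemma separating_rate t : K < 0 -> 0 < w 0 -> 0 <= t <= T ->
  Num.sqrt (- (4 * K)) * (1 - expR (- z 0)) <= w t * (1 - expR (- z t)).
Proof.
move=> K0 w0 tT; have wt := momentum_sign_gt0 K0 w0 tT.
apply: ler_pM; first exact: sqrtr_ge0.
- by rewrite ltW// gap_gt0// lexx.
- rewrite -[w t]ger0_norm ?(ltW wt)// -sqrtr_sqr ler_wsqrtr//.
  apply: (le_trans (energy_ge tT)).
  by rewrite ler_piMr ?sqr_ge0// ltW// one_sub_expRN_lt1.
- by rewrite lerD2l lerN2 ler_expR lerN2 separating_distance.
Qed.

Lemma approaching_distance t :
  (forall x, 0 < x < t -> w x <= 0) -> 0 <= t <= T -> z t <= z 0.
Proof.
move=> w_le0 /andP[t0 tT].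
rewrite -subr_le0 -[leRHS](mul0r (t - 0)).
apply: (primitive_upto_le (distance_ode zw)) => // x /andP[x0 xt].
have xT : 0 <= x <= T by rewrite ltW//= ltW// (lt_le_trans xt).
by rewrite pmulr_lle0 ?gap_gt0// w_le0// x0.
Qed.

(** The square root of 1 - exp (- z) is positive, but it decreases at least at
the rate exp (- z 0) * sqrt (- 4 K) / 2: its derivative is
w exp (- z) sqrt (1 - exp (- z)) / 2, where the energy identity bounds
- w sqrt (1 - exp (- z)) below by sqrt (- 4 K).  This limits how long the motion
can go on without a collision. *)
Lemma approaching_time : K < 0 -> w 0 < 0 ->
  expR (- z 0) * Num.sqrt (- (4 * K)) * T < 2 * Num.sqrt (1 - expR (- z 0)).
Proof.
move=> K0 w0; pose f t := Num.sqrt (1 - expR (- z t)).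
have gapT t : 0 < t <= T -> 0 < 1 - expR (- z t).
  by move=> /andP[/ltW t0 tT]; apply: gap_gt0; rewrite t0.
have fE : primitive_upto T f (fun t => w t * expR (- z t) * f t / 2).
  apply: (primitive_upto_eq (df := fun t =>
    (2 * Num.sqrt (1 - expR (- z t)))^-1
      * (expR (- z t) * (w t * (1 - expR (- z t)))))).
    apply: (primitive_upto_comp (h := Num.sqrt)
      (dh := fun x => (2 * Num.sqrt x)^-1) _ _
      (primitive_upto_comp (h := fun x => 1 - expR (- x))
        (dh := fun x => expR (- x)) _ _ (distance_ode zw))).
    - exact: sqrt_continuous.
    - by move=> t tT; apply: is_derive1_sqrt; exact: gapT.
    - exact: continuous_one_sub_expRN.
    - by move=> t tT; exact: is_derive_one_sub_expRN.
  move=> t tT; rewrite /f.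
  rewrite -[X in _ * (_ * (_ * X))](sqr_sqrtr (ltW (gapT t tT))).
  have : Num.sqrt (1 - expR (- z t)) != 0 by rewrite gt_eqF// sqrtr_gt0 gapT.
  move: (w t) (expR (- z t)) (Num.sqrt (1 - expR (- z t))) => a b c c0.
  by field.
have fT : 0 < f T by rewrite sqrtr_gt0 gap_gt0// T_ge0 lexx.
suff : f T - f 0 <= - (expR (- z 0) * Num.sqrt (- (4 * K)) / 2) * (T - 0).
  by rewrite subr0 -/(f 0); move: (expR _ * _) => a; lra.
apply: (primitive_upto_le fE) => // x /andP[x0 xT].
have {}xT : 0 <= x <= T by rewrite ltW//= ltW.
have w_lt0 t : 0 <= t <= T -> w t < 0 by exact: momentum_sign_lt0.
have wf : Num.sqrt (- (4 * K)) <= - w x * f x.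
  rewrite -[- w x]ger0_norm ?oppr_ge0 ?(ltW (w_lt0 _ xT))//.
  rewrite normrN -sqrtr_sqr -sqrtrM ?sqr_ge0// ler_wsqrtr//.
  exact: energy_ge.
have zx : expR (- z 0) <= expR (- z x).
  rewrite ler_expR lerN2; apply: approaching_distance => // t /andP[t0 tx].
  case/andP: xT => _ xT.
  by apply: ltW; apply: w_lt0; rewrite ltW// ltW// (lt_le_trans tx).
have : expR (- z 0) * Num.sqrt (- (4 * K)) <= expR (- z x) * (- w x * f x).
  by apply: ler_pM; rewrite ?expR_ge0 ?sqrtr_ge0.
lra.
Qed.

Lemma attracting_momentum a b :
  0 < K -> 0 <= a -> a <= b -> b <= T -> w a <= w b.
Proof.
move=> K0 a0 ab bT.
rewrite -subr_ge0 -[X in X <= _](mul0r (b - a)).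
apply: (primitive_upto_ge (momentum_ode zw)) => // x /andP[ax xb].
have xT : 0 <= x <= T.
  by rewrite (le_trans a0 (ltW ax))/= ltW// (lt_le_trans xb).
by rewrite divr_ge0 ?mulr_ge0 ?expR_ge0 ?(ltW K0)// ltW// gap_gt0.
Qed.

(** If w is still nonpositive at time T, it has been so all along, as it
increases; then z never exceeded z 0, which bounds w' below by
2 K exp (- z 0).  So the peakons cannot approach each other forever. *)
Lemma attracting_turn : 0 < K -> w T <= 0 ->
  2 * K * expR (- z 0) * T <= - w 0.
Proof.
move=> K0 wT.
have w_le0 x : 0 <= x <= T -> w x <= 0.
  move=> /andP[x0 xT].
  exact: le_trans (attracting_momentum K0 x0 xT (lexx T)) wT.
have z_le x : 0 <= x <= T -> z x <= z 0.
  move=> /[dup] xT /andP[_ x_le]; apply: approaching_distance => // s.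
  by move=> /andP[s0 sx]; apply: w_le0; rewrite ltW// ltW// (lt_le_trans sx).
suff : 2 * K * expR (- z 0) * (T - 0) <= w T - w 0 by rewrite subr0; lra.
apply: (primitive_upto_ge (momentum_ode zw)) => // x /andP[x0 xt].
have xT : 0 <= x <= T by rewrite ltW//= ltW.
rewrite ler_pdivlMr ?gap_gt0//.
apply: (@le_trans _ _ (2 * K * expR (- z 0))).
  by rewrite ler_piMr ?ltW ?one_sub_expRN_lt1// mulr_gt0 ?expR_gt0// mulr_gt0.
by rewrite ler_pM2l ?mulr_gt0// ler_expR lerN2 z_le.
Qed.

End relative_motion.

(** Integrating z' >= c from time a on. *)
Lemma escape (R : realType) (K S a c : R) (z w : R -> R) :
  (forall T, 0 <= T -> relative_motion K S z w T) -> 0 <= a -> 0 < c ->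
  (forall t, a <= t -> c <= w t * (1 - expR (- z t))) ->
  z t @[t --> +oo] --> +oo.
Proof.
move=> zw a0 c0 rate; apply/cvgryPge => A; near=> t.
have at_ : a <= t by near: t; apply: nbhs_pinfty_ge; rewrite num_real.
have t0 : 0 <= t by exact: le_trans at_.
have : c * (t - a) <= z t - z a.
  apply: (primitive_upto_ge (distance_ode (zw t t0))) => // x /andP[/ltW ax _].
  exact: rate.
suff : A - z a <= c * (t - a) by lra.
rewrite mulrC -ler_pdivrMr// lerBrDr; near: t; apply: nbhs_pinfty_ge.
by rewrite num_real.
Unshelve. all: by end_near. Qed.

(** * From the Hamiltonian system to the relative motion *)

Lemma cvg_coord (R : realType) (n : nat) (T : Type) (F : set_system T)
  (f : T -> 'rV[R]_n) (l : 'rV[R]_n) (i : 'I_n) : Filter F ->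
  f x @[x --> F] --> l -> f x ord0 i @[x --> F] --> l ord0 i.
Proof.
move=> FF; apply: (@continuous_cvg _ _ _ _ _ f (fun M : 'rV[R]_n => M ord0 i)).
exact: coord_continuous.
Qed.

Section twopeakon.
Variables (R : realType) (u : R -> R -> R) (q p : R -> 'rV[R]_2).
Hypotheses (sol : twopeakon_solution u q p) (q0_Omega : Omega R (q 0)).

Let z t := q t ord0 ord0 - q t ord0 ord_max.
Let w t := p t ord0 ord0 - p t ord0 ord_max.

Lemma distance_continuous : {within `[0, +oo[, continuous z}.
Proof.
have /continuous_within_itvcyP[qc q0] := twopeakon_q_continuous sol.
apply/continuous_within_itvcyP; split=> [t t0|].
  by apply: cvgB; apply: cvg_coord; exact: qc.
by apply: cvgB; exact: cvg_coord.
Qed.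

Lemma momentum_right_continuous i : p t ord0 i @[t --> 0^'+] --> p 0 ord0 i.
Proof. by apply: cvg_coord; exact: (twopeakon_p_initial sol). Qed.

(** By the intermediate value theorem the peakons cannot change order without
meeting. *)
Lemma no_collision_Omega T t : no_collision_upto q T -> 0 <= t <= T ->
  Omega R (q t).
Proof.
move=> nc /andP[t0 tT]; rewrite /Omega/= -subr_gt0.
apply: (nonvanishing_gt0 (f := z) t0); last by rewrite subr_gt0.
  apply: continuous_subspaceW distance_continuous => x /=.
  by rewrite !in_itv/= => /andP[->].
move=> x /andP[x0 xt]; rewrite subr_eq0; apply/eqP.
by apply: (nc x); rewrite x0 (le_trans xt).
Qed.

Lemma no_collisionW T t : no_collision_upto q T -> t <= T ->
  no_collision_upto q t.
Proof.
by move=> nc tT s /andP[s0 st]; apply: nc; rewrite s0 (le_trans st).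
Qed.

(** Hamilton's equations on the region q_1 > q_2, rewritten for the distance and
the relative momentum. *)
Lemma relative_motion_upto T : 0 <= T -> no_collision_upto q T ->
  relative_motion
    (p 0 ord0 ord0 * p 0 ord0 ord_max * (1 - expR (- z 0))) (H0 (p 0)) z w T.
Proof.
move=> T0 nc; set K := _ * (1 - _).
pose p1 t := p t ord0 ord0; pose p2 t := p t ord0 ord_max.
have yE t : q t ord0 ord_max - q t ord0 ord0 = - z t by rewrite opprB.
have z_gt0 t : 0 <= t <= T -> 0 < z t.
  by move=> /(no_collision_Omega nc); rewrite /Omega/= -subr_gt0.
have p1E : primitive_upto T p1 (fun t => p1 t * p2 t * expR (- z t)).
  split=> [|t /andP[t0 tT]]; first exact: momentum_right_continuous.
  have := twopeakon_p_ode sol t0 (no_collisionW nc tT) ord0.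
  rewrite partial_q_ord0 ?opprK ?yE//.
  by apply: (no_collision_Omega nc); rewrite (ltW t0).
have p2E : primitive_upto T p2 (fun t => - (p1 t * p2 t * expR (- z t))).
  split=> [|t /andP[t0 tT]]; first exact: momentum_right_continuous.
  have := twopeakon_p_ode sol t0 (no_collisionW nc tT) ord_max.
  rewrite partial_q_ord_max ?yE//.
  by apply: (no_collision_Omega nc); rewrite (ltW t0).
have zE : primitive_upto T z (fun t => w t * (1 - expR (- z t))).
  split=> [|t /andP[t0 tT]].
    by have /continuous_within_itvcyP[] := distance_continuous.
  have tO : Omega R (q t) by apply: (no_collision_Omega nc); rewrite (ltW t0).
  have d1 := twopeakon_q_ode sol t0 (no_collisionW nc tT) ord0.
  have d2 := twopeakon_q_ode sol t0 (no_collisionW nc tT) ord_max.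
  apply: is_derive_eq (is_deriveB d1 d2) _.
  rewrite partial_p_ord0 ?partial_p_ord_max// yE /w.
  by move: (expR _) (p _ _ _) (p _ _ _) => y a b; ring.
pose g t := 1 - expR (- z t).
have gE : primitive_upto T g (fun t => expR (- z t) * (w t * g t)).
  apply: (primitive_upto_comp (h := fun x => 1 - expR (- x))
    (dh := fun x => expR (- x)) _ _ zE).
    exact: continuous_one_sub_expRN.
  by move=> x xT; exact: is_derive_one_sub_expRN.
have SE t : 0 <= t <= T -> p1 t + p2 t = H0 (p 0).
  move=> tT; rewrite /H0 !big_ord_recr big_ord0/= add0r.
  rewrite (_ : widen_ord _ _ = ord0); last exact/val_inj.
  apply: (primitive_upto_cst (primitive_uptoD p1E p2E) _ tT) => x _.
  by rewrite subrr.
(* (p_1 p_2)' = - p_1 p_2 w y and (1 - y)' = y w (1 - y) cancel out. *)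
have KE t : 0 <= t <= T -> p1 t * p2 t * g t = K.
  move=> tT.
  apply: (primitive_upto_cst
    (primitive_uptoM (primitive_uptoM p1E p2E) gE) _ tT) => x _.
  rewrite /g /w -/(p1 x) -/(p2 x).
  by move: (expR _) (p1 x) (p2 x) => y a b; ring.
split=> //.
- apply: (primitive_upto_eq (primitive_uptoB p1E p2E)) => t /andP[t0 tT].
  have tT' : 0 <= t <= T by rewrite ltW.
  have := gt_eqF (one_sub_expRN_gt0 (z_gt0 t tT')).
  rewrite -(KE t tT') /g; move: (expR _) (p1 t) (p2 t) => y a b y1.
  by field; rewrite y1.
- move=> t tT; rewrite -(SE t tT) -(KE t tT) /g /w -/(p1 t) -/(p2 t).
  by move: (expR _) (p1 t) (p2 t) => y a b; ring.
Qed.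

(** Let a be the infimum of the collision times.  Before a, the bound m <= z
holds; by continuity from the left it also holds at a, so z stays positive
shortly after a, and collision times cannot accumulate at a. *)
Lemma no_collision_of_lower_bound m : 0 < m ->
  (forall T, 0 <= T -> no_collision_upto q T -> m <= z T) ->
  forall T, no_collision_upto q T.
Proof.
move=> m0 zm T s /andP[s0 _] qs.
pose C := [set s | 0 <= s /\ collision q s].
have C0 : lbound C 0 by move=> x [].
have Cn : C !=set0 by exists s.
have Ci : has_inf C by split=> //; exists 0.
pose a := inf C.
have a_ge0 : 0 <= a by exact: lb_le_inf.
have za T' : 0 <= T' -> T' < a -> m <= z T'.
  move=> T0 Ta; apply: zm => // r /andP[r0 rT] qr.
  have : a <= r by apply: ge_inf; [exact: Ci.2|split].
  by rewrite leNgt (le_lt_trans rT).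
have /continuous_within_itvcyP[zc z0c] := distance_continuous.
have zC x : C x -> z x = 0.
  by move=> [_]; rewrite /collision /z => ->; rewrite subrr.
have right_limit : z x @[x --> a^'+] --> z a.
  have [<-//|an0] := eqVneq 0 a.
  apply: cvg_at_right_filter; apply: zc.
  by rewrite in_itv/= andbT lt_neqAle an0.
(* Collision times lie at a or arbitrarily close to its right. *)
have za_le0 : z a <= 0.
  rewrite leNgt; apply/negP => za_gt0.
  have [e /= e0 ez] : \forall x \near a^'+, 0 < z x.
    by exact: cvgr_gt right_limit _ za_gt0.
  have [x Cx xae] := inf_adherent e0 Ci.
  have : a <= x by apply: ge_inf => //; exact: Ci.2.
  rewrite le_eqVlt => /orP[/eqP ax|ax].
    by move: za_gt0; rewrite ax zC// ltxx.
  have := ez x; rewrite (zC x Cx) ltxx => /(_ _ ax) false.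
  apply/notF/false.
  by rewrite /ball_/= ltr0_norm ?subr_lt0// opprB ltrBlDl.
have a_gt0 : 0 < a.
  rewrite lt_neqAle a_ge0 andbT; apply/eqP => a0.
  by move: za_le0; rewrite -a0 leNgt subr_gt0 q0_Omega.
have : \forall x \near a^'-, z x < m.
  apply: (cvgr_lt (z a)); last exact: le_lt_trans m0.
  by apply: cvg_at_left_filter; apply: zc; rewrite in_itv/= a_gt0.
move=> /(filterI (nbhs_left_gt a_gt0)) /(filterI (nbhs_left_lt a)).
move=> /filter_ex[x [/= xa [x0]]].
by rewrite ltNge za// ltW.
Qed.

End twopeakon.

(** * Collision or escape *)

(* [2 * H_1 - H_0 ^ 2 <> 0] says that the formula for t* has a nonzero
   denominator; for q_1 > q_2 it amounts to p_1 p_2 <> 0. *)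
Theorem theorem3p2 (R : realType) (u : R -> R -> R) (q p : R -> 'rV[R]_2)
  (sol : twopeakon_solution u q p)
  (q0_Omega : Omega R (q 0))
  (denom_neq0 : 2 * H (q 0) (p 0) - H0 (p 0) ^+ 2 != 0) :
  (exists tau : R, 0 < tau <= tstar (q 0) (p 0) /\ collision q tau) \/
  (q t ord0 ord0 - q t ord0 ord_max @[t --> +oo] --> +oo).
Proof.
pose z t := q t ord0 ord0 - q t ord0 ord_max.
pose w t := p t ord0 ord0 - p t ord0 ord_max.
pose K := p 0 ord0 ord0 * p 0 ord0 ord_max * (1 - expR (- z 0)).
have z0_gt0 : 0 < z 0 by rewrite subr_gt0.
have yE : q 0 ord0 ord_max - q 0 ord0 ord0 = - z 0 by rewrite opprB.
have g0 := one_sub_expRN_gt0 z0_gt0.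
have DE : 2 * H (q 0) (p 0) - H0 (p 0) ^+ 2 = - (2 * K).
  rewrite H_Omega// yE /H0 !big_ord_recr big_ord0/= add0r /K.
  rewrite (_ : widen_ord _ _ = ord0); last exact/val_inj.
  by move: (expR _) (p _ _ _) (p _ _ _) => y a b; field.
have motion := relative_motion_upto sol q0_Omega.
rewrite -/z -/w -/K in motion; clearbody K.
have nc0 : no_collision_upto q 0.
  move=> s; rewrite -eq_le => /eqP <- c0.
  by move: z0_gt0; rewrite /z c0 subrr ltxx.
have never := no_collision_of_lower_bound sol q0_Omega.
have [K_lt0|K_gt0|K_eq0] := ltgtP K 0; last first.
- by move: denom_neq0; rewrite DE K_eq0 mulr0 oppr0 eqxx.
- right.
  have S_gt0 : 0 < H0 (p 0) ^+ 2.
    have := gap_ge (motion 0 (lexx _) nc0) (t := 0); rewrite lexx => /(_ isT).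
    move=> h; rewrite -(pmulr_lgt0 _ g0); lra.
  pose m := 4 * K / H0 (p 0) ^+ 2.
  have m_gt0 : 0 < m by rewrite divr_gt0// mulr_gt0.
  have gap T : 0 <= T -> no_collision_upto q T -> m <= 1 - expR (- z T).
    move=> T0 nc; rewrite ler_pdivrMr// [leRHS]mulrC.
    by apply: (gap_ge (motion T T0 nc)); rewrite T0 lexx.
  have nc : forall T, no_collision_upto q T.
    apply: (never m m_gt0) => T T0 nc.
    exact: le_trans (gap T T0 nc) (one_sub_expRN_le _).
  (* At the time |w 0| / (2 K y(0)) the bound of [attracting_turn] may still be
     attained; one unit of time later it is violated. *)
  pose a := `|w 0| / (2 * K * expR (- z 0)) + 1.
  have den_gt0 : 0 < 2 * K * expR (- z 0) by rewrite !mulr_gt0 ?expR_gt0.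
  have a_gt0 : 0 < a.
    by apply: ltr_wpDl; [apply: divr_ge0; [exact: normr_ge0|exact: ltW]|].
  have wa : 0 < w a.
    rewrite ltNge; apply/negP => wa.
    have := attracting_turn (ltW a_gt0) (motion a (ltW a_gt0) (nc a)) K_gt0 wa.
    apply/negP; rewrite -ltNge /a mulrDr mulr1 mulrC divfK ?gt_eqF//.
    by have := ler_norm (- w 0); rewrite normrN; lra.
  apply: (escape (a := a) (c := w a * m)
    (fun T T0 => motion T T0 (nc T)) (ltW a_gt0)); first exact: mulr_gt0.
  move=> t at_; have t0 : 0 <= t by rewrite (le_trans (ltW a_gt0)).
  apply: ler_pM; rewrite ?(ltW wa) ?(ltW m_gt0)//.
    exact: (attracting_momentum (motion t t0 (nc t)) K_gt0 (ltW a_gt0)).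
  exact: gap.
have := momentum_neq0 (motion 0 (lexx _) nc0) (t := 0) K_lt0.
rewrite lexx => /(_ isT); rewrite neq_lt => /orP[w0|w0]; last first.
- right.
  have nc : forall T, no_collision_upto q T.
    apply: (never (z 0) z0_gt0) => T T0 nc.
    by apply: (separating_distance (motion T T0 nc) K_lt0 w0); rewrite T0 lexx.
  apply: (escape (a := 0) (c := Num.sqrt (- (4 * K)) * (1 - expR (- z 0)))
    (fun T T0 => motion T T0 (nc T)) (lexx _)).
    by rewrite mulr_gt0// sqrtr_gt0; lra.
  move=> t t0; apply: (separating_rate t0 (motion t t0 (nc t)) K_lt0 w0).
  by rewrite t0 lexx.
- left; apply: contrapT => no_tau.
  set ts := tstar _ _ in no_tau.
  have y_gt0 : 0 < expR (- z 0) by exact: expR_gt0.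
  pose d := Num.sqrt ((1 + expR (- z 0)) * - (2 * K)).
  have d_gt0 : 0 < d by rewrite sqrtr_gt0 mulr_gt0//; lra.
  have tsE : ts = 2 * Num.sqrt (1 - expR (- z 0)) / (expR (- z 0) * d).
    by rewrite /ts /tstar DE yE.
  have ts_gt0 : 0 < ts by rewrite tsE divr_gt0 ?mulr_gt0// sqrtr_gt0.
  have nc : no_collision_upto q ts.
    move=> s /andP[s0 sts] qs; have [s0'|sn0] := eqVneq 0 s.
      by apply: (nc0 s) => //; rewrite -s0' lexx.
    by apply: no_tau; exists s; rewrite lt_neqAle sn0 s0 sts.
  have := approaching_time (ltW ts_gt0) (motion ts (ltW ts_gt0) nc) K_lt0 w0.
  apply/negP; rewrite -leNgt tsE mulrA ler_pdivlMr ?mulr_gt0//.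
  rewrite mulrC ler_pM2r ?mulr_gt0 ?sqrtr_gt0//.
  rewrite ler_pM2l// ler_wsqrtr//.
  (* What remains is (1 + y(0)) (- 2 K) <= - 4 K. *)
  have : (1 - expR (- z 0)) * K <= 0 by rewrite pmulr_rle0// ltW.
  by lra.
Qed.
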